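(* Assume $\mathfrak{r} = \mathfrak{c}$. Let $X$ and $Y$ be isodyne topological spaces with $\mathrm{cf}|X| = \omega$ and $\mathrm{cf}|Y| = \mathrm{cf}(\mathfrak{c})$. Then the product space $X \times Y$ is $\omega$-resolvable. If, moreover, $\mathrm{cf}(\mathfrak{c}) = \omega_1$, then the space $X \times Y$ is $\omega_1$-resolvable.
   Context: For a topological space $Z$, the dispersion character is $\Delta(Z) = \min\{|U| : U \text{ is a nonempty open subset of } Z\}$. A space $Z$ is isodyne if $|Z| = \Delta(Z)$. For a cardinal $\tau$, a space $Z$ is $\tau$-resolvable if $Z$ can be partitioned into $\tau$-many (pairwise disjoint) dense subsets. $\mathfrak{c} = 2^\omega$ and $\mathrm{cf}$ denotes cofinality. A set $S \subseteq \omega$ splits a set $A \subseteq \omega$ if both $A \cap S$ and $A \setminus S$ are infinite. A family $\mathcal{R}$ of infinite subsets of $\omega$ is unsplittable if no single set $S \subseteq \omega$ splits all members of $\mathcal{R}$. The unsplitting number $\mathfrak{r}$ is the smallest cardinality of an unsplittable family. No separation axioms are assumed. *)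

(* Defs.v *)
From mathcomp Require Import all_boot.
From mathcomp Require Import boolp classical_sets functions cardinality wochoice.
From mathcomp Require Import topology.

Set Implicit Arguments.
Unset Strict Implicit.
Unset Printing Implicit Defensive.

Local Open Scope classical_set_scope.
Local Open Scope card_scope.

(* There is no type of cardinals: a cardinal is represented by an arbitrary
   type [K] having that cardinality, and cardinals are compared by means of
   [#=] and [#<=] applied to full sets.
   [has_min_card F K] means |K| = min {|A| : A in F}. *)
Definition has_min_card (U : Type) (F : set (set U)) (K : Type) : Prop :=
  (exists2 A, F A & A #= [set: K]) /\ (forall A, F A -> [set: K] #<= A).

(* [R] orders [T] in the type of an initial ordinal, namely that of |T|. *)
Definition initial_well_order (T : Type) (R : rel T) : Prop :=
  well_order R /\ forall x, ~~ ([set: T] #<= [set y | R y x /\ y <> x]).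

Definition cofinal (T : Type) (R : rel T) (A : set T) : Prop :=
  forall x, exists2 y, A y & R x y.

(* cf|T| = |K|.  Initial well-orders of [T] exist and are pairwise isomorphic,
   so the choice of [R] is irrelevant. *)
Definition has_cofinality (T K : Type) : Prop :=
  exists2 R : rel T, initial_well_order R & has_min_card (cofinal R) K.

(* [W] has the cardinality of the first uncountable ordinal. *)
Definition is_omega1 (W : Type) : Prop :=
  ~ countable [set: W] /\
  exists2 R : rel W, well_order R &
    forall x, countable [set y | R y x /\ y <> x].

(* 2^omega *)
Definition continuum : Type := nat -> bool.

Definition has_dispersion_character (Z : topologicalType) (K : Type) : Prop :=
  has_min_card [set U : set Z | open U /\ U !=set0] K.

Definition isodyne (Z : topologicalType) : Prop := has_dispersion_character Z Z.

Definition resolvable (K : Type) (Z : topologicalType) : Prop :=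
  exists2 D : K -> set Z, partition [set: K] D [set: Z] & forall i, dense (D i).

Definition splits (S A : set nat) : Prop :=
  infinite_set (A `&` S) /\ infinite_set (A `\` S).

Definition unsplittable (R : set (set nat)) : Prop :=
  (forall A, R A -> infinite_set A) /\ ~ exists S, forall A, R A -> splits S A.

Definition has_unsplitting_number (K : Type) : Prop :=
  has_min_card unsplittable K.

(* Main.v *)
Require Import Defs.
From mathcomp Require Import all_boot.
From mathcomp Require Import boolp classical_sets functions cardinality wochoice.
From mathcomp Require Import topology.

(** Write the cardinal |X| of countable cofinality as the union of an increasing
sequence of smaller sets. This ranks the points of X by natural numbers, and
since a nonempty open set of X has full cardinality |X|, its ranks form an
infinite subset of omega. In the same way Y is ranked by the ordinal
mu = cf(c), and every nonempty open set of Y has ranks cofinal in mu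
([cofinality_rank]). It is therefore enough to colour omega x mu so that every
product A x B, with A infinite and B cofinal in mu, receives all colours
([product_resolvable]): the colour classes, pulled back to X x Y along the two
ranks, are then dense.

The colouring comes from r = c. The infinite subsets of omega form an
increasing union of families F_k, k < mu, each of size less than c. As r = c,
each F_k is split by one set, and so is the family of traces of F_k on any set
meeting all its members in infinite sets. Splitting again and again yields, for
each k, a partition of omega into infinitely many pieces such that every piece
meets every member of F_k ([small_family_coloring]). Colour (n, k) by the index
of the piece of the k-th partition that contains n. An infinite set A lies in
F_k for all large k, and any cofinal B contains such a k, so A x B receives
every natural number ([splitting_colorings]).

If cf(c) = omega_1, then each k < omega_1 has countably many predecessors; enumerate
them as e_k(0), e_k(1), ... and replace the colour n at level k by e_k(n). A
given i < omega_1 is among the e_k(n) for all large k, so A x B now receives all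
colours below omega_1.

Cofinalities are computed here from arbitrary initial well-orders, so two facts
are needed that are implicit in the language of ordinals: every set has an
initial well-order ([initial_well_order_exists]), and the cofinality does not
depend on it ([cofinality_unique]). *)

Set Implicit Arguments.
Unset Strict Implicit.
Unset Printing Implicit Defensive.

Local Open Scope classical_set_scope.
Local Open Scope card_scope.

(** * Well-orders and cardinal comparison *)

Definition below (T : Type) (R : rel T) (x : T) : set T :=
  [set y | R y x /\ y <> x].

(** Comparison of cardinals is defined through maps between subtypes; for a full
source this unfolds to a plain injective function. *)
Lemma card_leTP (T U : Type) (B : set U) :
  [set: T] #<= B <-> exists2 f : T -> U, injective f & forall x, B (f x).
Proof.
split.
  case/card_leP => f; exists (fun x => val (f (SigSub (in_setT x)))).
    move=> x y /val_inj /(inj (f := f)) E.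
    have {}E := E (in_setT _) (in_setT _).
    by have := congr1 val E.
  move=> x; exact: set_valP.
case=> f f_inj fB.
have := inj_card_eq (A := setT) (in2W f_inj).
by rewrite card_eq_le => /andP[_] /card_le_trans; apply; apply: subset_card_le => _ [x _ <-]; exact: fB.
Qed.

Lemma well_order_least (T : Type) (R : rel T) (P : set T) :
  well_order R -> P !=set0 -> exists2 z, P z & forall y, P y -> R z y.
Proof.
move=> woR [x Px].
have [|z [[/asboolP Pz minz] _]] := woR (fun y => `[< P y >]).
  by exists x; apply/asboolP.
by exists z => // y Py; apply: minz; apply/asboolP.
Qed.

Lemma well_order_total (T : Type) (R : rel T) :
  well_order R -> forall x y, R x y \/ R y x.
Proof.
move=> woR x y.
have [|z Pz minz] := @well_order_least T R [set z | z = x \/ z = y] woR.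
  by exists x; left.
by case: Pz => <-; [left; apply: minz; right | right; apply: minz; left].
Qed.

Lemma well_order_refl (T : Type) (R : rel T) :
  well_order R -> forall x, R x x.
Proof. by move=> woR x; case: (well_order_total woR x x). Qed.

Lemma well_order_anti (T : Type) (R : rel T) :
  well_order R -> forall x y, R x y -> R y x -> x = y.
Proof.
move=> woR x y Rxy Ryx; have Rrefl := well_order_refl woR.
have [|z [_ uniqz]] := woR (fun z => `[< z = x \/ z = y >]).
  by exists x; apply/asboolP; left.
rewrite -(uniqz x) ?(uniqz y) //.
  by split=> [|z' /asboolP[]->] //; apply/asboolP; right.
by split=> [|z' /asboolP[]->] //; apply/asboolP; left.
Qed.

Lemma well_order_trans (T : Type) (R : rel T) :
  well_order R -> forall x y z, R x y -> R y z -> R x z.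
Proof.
move=> woR x y z Rxy Ryz.
have [|m Pm minm] :=
    @well_order_least T R [set m | [\/ m = x, m = y | m = z]] woR.
  by exists x; constructor 1.
have [mx my mz] : [/\ R m x, R m y & R m z].
  by split; apply: minm; [constructor 1|constructor 2|constructor 3].
case: Pm => E; rewrite E in mx my mz => //.
  by rewrite -(well_order_anti woR mx Rxy).
by rewrite -(well_order_anti woR Ryz my).
Qed.

(** The argument order is that of the segments: [below R x y] places [y]
strictly under [x]. *)
Lemma belowP (T : Type) (R : rel T) :
  well_order R -> forall x y, below R x y <-> ~ R x y.
Proof.
move=> woR x y; split=> [[Ryx neq] Rxy|nRxy].
  by apply: neq; apply: (well_order_anti woR).
split; first by case: (well_order_total woR x y).
by move=> E; apply: nRxy; rewrite E; apply: well_order_refl.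
Qed.

Lemma below_wf (T : Type) (R : rel T) :
  well_order R -> well_founded (fun y x => below R x y).
Proof.
move=> woR x; apply: contrapT => nx.
have [|z nz minz] := @well_order_least T R [set z | ~ Acc (fun y x => below R x y) z] woR.
  by exists x.
apply: nz; constructor=> y /(belowP woR) nRzy.
by apply: contrapT => /minz.
Qed.

(** * Initial well-orders and uniqueness of cofinality *)

(** If some proper segment of a well-order of [T] is as large as [T], then the
least point with such a segment gives an embedding of [T] into a segment all of
whose own segments are small; pull the order back along it. *)
Lemma initial_well_order_exists (T : Type) : exists R : rel T, initial_well_order R.
Proof.
have [R woR] := well_ordering_principle {classic T}.
have [[x Tx]|small] := pselect (exists x, [set: T] #<= below R x); last first.
  by exists R; split=> // x; apply/negP => Tx; apply: small; exists x.
have [|z Tz minz] := @well_order_least T R [set x | [set: T] #<= below R x] woR.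
  by exists x.
have [f f_inj fz] := (card_leTP _ _).1 Tz.
exists (fun a b => R (f a) (f b)); split.
  move=> A [a Aa].
  have [|_ [b Ab <-] minb] := @well_order_least T R (f @` [set a | a \in A]) woR.
    by exists (f a), a.
  exists b; split; first by split=> // c Ac; apply: minb; exists c.
  move=> c [Ac minc]; apply: f_inj; apply: (well_order_anti woR).
    by apply: minb; exists c.
  exact: minc.
move=> a; apply/negP => /card_leTP [h h_inj hb].
apply: ((belowP woR _ _).1 (fz a)); apply: minz; apply/card_leTP.
exists (f \o h) => [b c /f_inj /h_inj //|b].
by have [Rb neq] := hb b; split => // /f_inj.
Qed.

(** The comparison map of two initial ordinals, by transfinite recursion: [x] is
sent to the [R']-least point not yet used. Such a point exists because the
points used so far are indexed by a segment of [R], which is smaller than [T]. *)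
Lemma initial_orders_embed (T : Type) (R R' : rel T) :
  initial_well_order R -> initial_well_order R' ->
  exists2 f : T -> T, injective f & forall x y, R x y -> R' (f x) (f y).
Proof.
move=> [woR smallR] [woR' smallR'].
pose avoids x (rec : forall y, below R x y -> T) : set T :=
  [set z | forall y (h : below R x y), rec y h <> z].
have avoids_ne x rec : avoids x rec !=set0.
  apply: contrapT => none; have /negP := smallR x; apply.
  have onto z : exists y : {y | below R x y}, rec (sval y) (proj2_sig y) = z.
    apply: contrapT => nz; apply: none; exists z => y h E.
    by apply: nz; exists (exist _ y h).
  have [g gK] := choice onto.
  apply/card_leTP; exists (fun z => sval (g z)) => [a b E|z]; last exact: (proj2_sig (g z)).
  by rewrite -(gK a) -(gK b) (eq_sig_hprop _ (g a) (g b)) // => w p q; exact: Prop_irrelevance.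
pose least x rec := cid2 (well_order_least woR' (avoids_ne x rec)).
pose f := Fix (below_wf woR) (fun _ => T) (fun x rec => s2val (least x rec)).
have fE x : f x = s2val (least x (fun y _ => f y)).
  rewrite /f Fix_eq // => {}x r1 r2 E.
  by congr (s2val (least _ _)); apply: functional_extensionality_dep => y; apply: funext.
have f_new x y : below R x y -> f y <> f x.
  by move=> h; rewrite [f x]fE; case: (least _ _) => z /= az _; apply: az.
have f_min x z : (forall y, below R x y -> f y <> z) -> R' (f x) z.
  by move=> h; rewrite [f x]fE; case: (least _ _) => w /= _; apply.
have f_inj : injective f.
  move=> x y E; apply: contrapT => neq.
  case: (well_order_total woR x y) => Rxy.
    by apply: (f_new y x).
  by apply: (f_new x y) => //; split=> // ?; apply: neq.
exists f => // x y Rxy; apply: f_min => z [Rzx neq] /f_inj E.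
by apply: neq; apply: (well_order_anti woR) => //; rewrite E.
Qed.

(** A monotone injection between two initial orders has cofinal range, because a
bounded range would embed [T] into a segment. Hence it carries cofinal sets to
cofinal sets, without increasing their size. *)
Lemma cofinality_unique (T K L : Type) :
  has_cofinality T K -> has_cofinality T L -> [set: K] #= [set: L].
Proof.
suff le K' L' : has_cofinality T K' -> has_cofinality T L' -> [set: K'] #<= [set: L'].
  by move=> TK TL; rewrite card_eq_le !le.
move=> [R iR [_ minK]] [R' iR' [[C cofC CL] _]].
have [f f_inj f_mono] := initial_orders_embed iR' iR.
apply: (@card_le_trans _ _ _ (f @` C)); last first.
  apply: card_le_trans (card_image_le _ _) _.
  by move: CL; rewrite card_eq_le => /andP[].
apply: minK => x.
have [t Rxt] : exists t, R x (f t).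
  apply: contrapT => none; have /negP := iR.2 x; apply; apply/card_leTP.
  exists f => // t; apply/(belowP iR.1) => Rxt; by apply: none; exists t.
have [c Cc R'tc] := cofC t.
exists (f c); first by exists c.
by apply: (well_order_trans iR.1 Rxt); apply: f_mono.
Qed.

Lemma has_cofinality_eq (T K L : Type) :
  [set: K] #= [set: L] -> has_cofinality T K -> has_cofinality T L.
Proof.
move=> KL [R iR [[C cofC CK] minK]]; exists R => //; split.
  by exists C => //; apply: card_eq_trans CK KL.
move=> A /minK; apply: card_le_trans.
by move: KL; rewrite card_eq_le => /andP[].
Qed.

(** Hilbert's hotel: shift a copy of the natural numbers that avoids [x], and
move [x] to its first place. *)
Lemma infinite_delete_point (T : Type) (x : T) :
  infinite_set [set: T] -> [set: T] #<= ~` [set x].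
Proof.
move=> infT; have : infinite_set (~` [set x]).
  move=> fin; apply: infT; rewrite -(setUv [set x]) finite_setU.
  by split=> //; apply: finite_set1.
move=> /infiniteP /card_leTP [i i_inj ix].
have idx t : exists s : option nat,
    if s is Some n then i n = t else forall n, i n <> t.
  have [[n <-]|none] := pselect (exists n, i n = t); first by exists (Some n).
  by exists None => n E; apply: none; exists n.
have [s sP] := choice idx.
have si n : s (i n) = Some n.
  by have := sP (i n); case: (s _) => [m /i_inj -> //|/(_ n)].
pose f t := if `[< t = x >] then i 0
            else if s t is Some n then i n.+1 else t.
apply/card_leTP; exists f; last first.
  move=> t; rewrite /f; case: asboolP => [tx|tx]; first exact: ix.
  by case: (s t) => [n|//]; apply: ix.
move=> a b; rewrite /f.
case: asboolP => [->|ax]; case: asboolP => [-> //|bx].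
- have := sP b; case: (s b) => [n _ /i_inj //|nb E].
  by have := nb 0; rewrite E.
- have := sP a; case: (s a) => [n _ /i_inj //|na E].
  by have := na 0; rewrite E.
- have := sP a; have := sP b; case: (s a) => [n|]; case: (s b) => [m|].
  + by move=> <- <- /i_inj [->].
  + by move=> nb _ E; have := nb n.+1; rewrite E.
  + by move=> _ na E; have := na m.+1; rewrite E.
  + by [].
Qed.

Lemma initial_no_max (T : Type) (R : rel T) :
  infinite_set [set: T] -> initial_well_order R ->
  forall x, exists y, below R y x.
Proof.
move=> infT [woR small] x; apply: contrapT => none.
have /negP := small x; apply; apply: card_le_trans (infinite_delete_point x infT) _.
apply: subset_card_le => y xy; apply/(belowP woR) => Rxy; apply: none.
by exists y; split=> // E; apply: xy.
Qed.

(** * Ranking a set by its cofinality *)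

(** A cofinal set of least size is enumerated by [K]. The enumeration need not be
monotone, but fewer than |K| of its values are never cofinal, which is what
regularity of the cofinality amounts to. *)
Lemma cofinality_index (T K : Type) (S : rel K) :
  has_cofinality T K -> initial_well_order S ->
  exists (R : rel T) (c : K -> T), [/\ initial_well_order R,
    cofinal R (range c) & forall k, exists x, forall j, below S k j -> below R x (c j)].
Proof.
move=> [R iR [[C cofC CK] minK]] iS.
have /card_bijP [f [g _ gK]] : [set: K] #= C by rewrite card_eq_sym.
exists R, (fun k => set_val (f (SigSub (mem_set (I : [set: K] k))))); split=> //.
  move=> x; have [y Cy Rxy] := cofC x; exists y => //.
  have [k kE] : exists k, g (SigSub (mem_set Cy)) = SigSub (mem_set (I : [set: K] k)).
    by exists (set_val (g (SigSub (mem_set Cy)))); apply: val_inj.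
  by exists k => //; rewrite -kE gK.
move=> k; apply: contrapT => none; have /negP := iS.2 k; apply.
apply: card_le_trans (card_image_le _ _); apply: minK => x.
apply: contrapT => nx; apply: none; exists x => j kj; apply/(belowP iR.1) => Rx.
by apply: nx; eexists; [exists j|exact: Rx].
Qed.

(** A last index [m] would make the greater of [c m] and a bound of all the other
values of [c] the greatest point of [T], which an infinite initial order does
not have. *)
Lemma cofinality_no_max (T K : Type) (S : rel K) :
  infinite_set [set: T] -> has_cofinality T K -> initial_well_order S ->
  forall k, exists j, below S j k.
Proof.
move=> infT TK iS m; apply: contrapT => none.
have [R [c [iR cofc bound]]] := cofinality_index TK iS.
have [x xP] := bound m.
have [y [Rcy]] : exists y, below R y (if `[< R x (c m) >] then c m else x).
  exact: initial_no_max.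
apply; have [_ [k _ <-] Ryc] := cofc y.
apply: (well_order_anti iR.1) => //; apply: (well_order_trans iR.1 Ryc).
have [Smk|/(belowP iS.1 _ _).2 /xP [Rcx _]] := pselect (S m k); last first.
  by case: asboolP => // Rx; apply: (well_order_trans iR.1 Rcx).
have -> : k = m.
  by apply: contrapT => neq; apply: none; exists k; split=> // E; apply: neq.
case: asboolP => [_|/(belowP iR.1 _ _).2 [] //].
exact: well_order_refl iR.1 _.
Qed.

(** The rank of [t] is the least [k] with [t] under [c k]. A set whose ranks all
lie below some [k] is bounded in [T], by the bound of the values of [c] below
[k]; so it is smaller than [T]. *)
Lemma cofinality_rank (T K : Type) (S : rel K) :
  has_cofinality T K -> initial_well_order S ->
  exists g : T -> K,
    forall V : set T, [set: T] #<= V -> cofinal S (g @` V).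
Proof.
move=> TK iS; have [R [c [iR cofc bound]]] := cofinality_index TK iS.
have rk t : exists k, R t (c k) /\ forall j, R t (c j) -> S k j.
  have [|k tk mink] := @well_order_least K S [set k | R t (c k)] iS.1.
    by have [_ [k _ <-] tk] := cofc t; exists k.
  by exists k.
have [g gP] := choice rk; exists g => V TV k.
apply: contrapT => none; have [x xP] := bound k.
have /negP := iR.2 x; apply; apply: card_le_trans TV _.
apply: subset_card_le => t Vt; have [Rtg _] := gP t.
have /xP [Rgx neq] : below S k (g t).
  by apply/(belowP iS.1) => Skg; apply: none; exists (g t) => //; exists t.
split; first exact: (well_order_trans iR.1 Rtg).
by move=> E; apply: neq; apply: (well_order_anti iR.1) => //; rewrite -E.
Qed.

Lemma leq_initial : initial_well_order leq.
Proof.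
split.
  apply: antisymmetric_well_order => [m n /anti_leq //|A [n An]].
  have exA : exists n, n \in A by exists n.
  by case: (ex_minnP exA) => m Am minm; exists m.
move=> n; apply/negP => le; apply: infinite_nat.
apply: card_le_finite le _; apply: sub_finite_set (finite_II n) => m [/= mn /eqP neq].
by rewrite ltn_neqAle neq.
Qed.

Lemma cofinal_leq_infinite (A : set nat) : cofinal leq A -> infinite_set A.
Proof.
move=> cofA /finite_seqP [s sE].
have [n] := cofA (\max_(m <- s) m).+1.
by rewrite sE /= => ns; rewrite ltnNge (@leq_bigmax_seq _ s xpredT id n).
Qed.

(** * Splitting and colourings of omega *)

Lemma infinite_continuum : infinite_set [set: continuum].
Proof.
apply/infiniteP/card_leTP; exists (fun n m => m == n) => // m n.
by move=> /(congr1 (fun f => f m)); rewrite eqxx => /esym/eqP.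
Qed.

(** A family smaller than r = c is split by some [S0]; its members minus [S0]
again form such a family, split by some [S1], and so on. The pieces
[S0], [S1] minus [S0], and so forth all meet every member of the family. *)
Lemma small_family_coloring (F : set (set nat)) :
  has_unsplitting_number continuum -> (forall A, F A -> infinite_set A) ->
  ~ ([set: continuum] #<= F) ->
  exists col : nat -> nat, forall A, F A -> forall n, exists2 a, A a & col a = n.
Proof.
move=> [_ r_le] infF smallF.
have split_trace R : exists S, (forall A, F A -> infinite_set (A `&` R)) ->
    forall A, F A -> splits S (A `&` R).
  (* Only traces that are all infinite are of interest; any set serves as a
     value otherwise, which makes the choice of the splitting set total. *)
  have [infR|?] := pselect (forall A, F A -> infinite_set (A `&` R)); last by exists setT.
  apply: contrapT => none; apply: smallF.
  apply: (@card_le_trans _ _ _ ((fun A => A `&` R) @` F)); last exact: card_image_le.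
  apply: r_le; split=> [_ [A FA <-]|[S Sspl]]; first exact: infR.
  by apply: none; exists S => _ A FA; apply: Sspl; exists A.
have [S SP] := choice split_trace.
pose rest := fix rest n := if n is m.+1 then rest m `\` S (rest m) else setT.
have rest_inf n A : F A -> infinite_set (A `&` rest n).
  elim: n A => [|n IHn] A FA; first by rewrite setIT; apply: infF.
  by have [_] := SP _ IHn A FA; rewrite /= setDE setIA -setDE.
have rest_le m n : m <= n -> rest n `<=` rest m.
  elim: n => [|n IHn]; first by rewrite leqn0 => /eqP ->.
  by rewrite leq_eqVlt => /orP[/eqP ->//|/IHn sub a [/sub]].
(* The colour of a point is the stage at which it leaves the sets [rest n];
   points that never leave receive an arbitrary colour. *)
have level a : exists n, forall m, rest m a -> ~ rest m.+1 a -> n = m.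
  have [[n [rn nrn]]|none] := pselect (exists n, rest n a /\ ~ rest n.+1 a).
    exists n => m rm nrm; apply/eqP; rewrite eqn_leq leqNgt [m <= n]leqNgt.
    apply/andP; split; apply/negP => lt; [apply: nrm|apply: nrn]; exact: rest_le lt _ _.
  by exists 0 => m rm nrm; case: none; exists m.
have [col colP] := choice level.
exists col => A FA n.
have [/infinite_setN0 [a [[Aa ra] Sa]] _] := SP _ (rest_inf n) A FA.
by exists a => //; apply: colP => //= -[].
Qed.

(** The [k]-th colouring takes care of the infinite sets of rank below [k],
through an identification of subsets of omega with points of the continuum.
There are fewer than c of them, since their ranks are not cofinal in [K]. *)
Lemma splitting_colorings (K : Type) (S : rel K) :
  has_unsplitting_number continuum -> has_cofinality continuum K ->
  initial_well_order S ->
  exists col : K -> nat -> nat, forall A, infinite_set A ->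
    exists k0, forall k, S k0 k -> forall n, exists2 a, A a & col k a = n.
Proof.
move=> r_eq_c cK iS.
have [g gP] := cofinality_rank cK iS.
pose code (A : set nat) : continuum := fun n => `[< A n >].
have code_inj : injective code.
  move=> A B E; apply/seteqP; split=> n An; apply/asboolP.
    by rewrite -[`[< _ >]]/(code B n) -E; apply/asboolP.
  by rewrite -[`[< _ >]]/(code A n) E; apply/asboolP.
pose F k := [set A : set nat | infinite_set A /\ below S k (g (code A))].
have smallF k : ~ ([set: continuum] #<= F k).
  move=> /card_leTP [f f_inj fF].
  have [_ [_ [s _ <-] <-] Skg] : exists2 y, (g @` range (code \o f)) y & S k y.
    apply: gP; apply/card_leTP; exists (code \o f); last by move=> s; exists s.
    by apply: inj_comp.
  by have [_ /(belowP iS.1)] := fF s; apply.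
have infF k A : F k A -> infinite_set A by case.
have [col colP] := choice (fun k => small_family_coloring r_eq_c (infF k) (smallF k)).
exists col => A infA.
(* [A] belongs to the families of index strictly above its rank, so a further
   index is needed. *)
have [k0 lt] := cofinality_no_max infinite_continuum cK iS (g (code A)).
exists k0 => k Sk0k; apply: (colP k A); split=> //.
apply/(belowP iS.1) => Skg; have /(belowP iS.1) := lt; apply.
exact: (well_order_trans iS.1 Sk0k Skg).
Qed.

(** * Resolvability of the product *)

Lemma isodyne_nbhs (Z : topologicalType) (z : Z) (A : set Z) :
  isodyne Z -> nbhs z A -> [set: Z] #<= A.
Proof.
move=> [_ isoZ] zA; apply: card_le_trans (subset_card_le (@interior_subset _ A)).
by apply: isoZ; split; [apply: open_interior | exists z].
Qed.

(** The colour of [(x, y)] is the colour that the rank of [y] assigns to the rank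
of [x]. In a box [U * V] the ranks of [U] form an infinite set [A], and the
ranks of [V], being cofinal, reach a level at which [A] shows the colour [i]. *)
Lemma product_resolvable (X Y : topologicalType) (K I : Type) (S : rel K)
    (h : K -> nat -> I) :
  isodyne X -> isodyne Y -> has_cofinality X nat -> has_cofinality Y K ->
  initial_well_order S ->
  (forall A, infinite_set A -> forall i,
    exists k0, forall k, S k0 k -> exists2 a, A a & h k a = i) ->
  resolvable I (X * Y)%type.
Proof.
move=> isoX isoY cfX cfY iS hP.
have [gX gXP] := cofinality_rank cfX leq_initial.
have [gY gYP] := cofinality_rank cfY iS.
pose D i : set (X * Y) := [set p | h (gY p.2) (gX p.1) = i].
have denseD i : dense (D i).
  move=> O [p Op] openO.
  have [[U V] /= [pU pV] UVO] : nbhs p O by apply: open_nbhs_nbhs.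
  have infU := cofinal_leq_infinite (gXP _ (isodyne_nbhs isoX pU)).
  have [k0 k0P] := hP _ infU i.
  have [_ [y Vy <-] /k0P [_ [x Ux <-] hi]] := gYP _ (isodyne_nbhs isoY pV) k0.
  by exists (x, y); split=> //; apply: UVO.
have ne (Z : topologicalType) : isodyne Z -> exists z : Z, True.
  by case=> -[U [_ [z _]] _] _; exists z.
have [[x _] [y _]] := (ne X isoX, ne Y isoY).
exists D => //; split=> [|i j _ _ [p [<- <-]] //|i _].
  by apply/seteqP; split=> // p _; exists (h (gY p.2) (gX p.1)).
have [|p [_ Dp]] := denseD i setT _ openT; first by exists (x, y).
by exists p.
Qed.

Lemma countable_range (T : Type) (A : set T) (t : T) :
  countable A -> exists e : nat -> T, A `<=` range e.
Proof.
move=> /countable_injP [f f_inj].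
have inv n : exists t', forall a, A a -> f a = n -> t' = a.
  have [[a [Aa fa]]|none] := pselect (exists a, A a /\ f a = n).
    by exists a => b Ab fb; apply: f_inj; rewrite ?inE // fa fb.
  by exists t => a Aa fa; case: none; exists a.
have [e eP] := choice inv; exists e => a Aa.
by exists (f a) => //; apply: eP.
Qed.

Theorem theorem6p3
  (r_eq_c : has_unsplitting_number continuum)
  (X Y : topologicalType)
  (isoX : isodyne X) (isoY : isodyne Y)
  (cfX : has_cofinality X nat)
  (cfY : exists K : Type, has_cofinality Y K /\ has_cofinality continuum K) :
  resolvable nat (X * Y)%type /\
  (forall W : Type, is_omega1 W -> has_cofinality continuum W ->
    resolvable W (X * Y)%type).
Proof.
have [K [YK cK]] := cfY; split.
  have [S iS] := initial_well_order_exists K.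
  have [col colP] := splitting_colorings r_eq_c cK iS.
  apply: (product_resolvable isoX isoY cfX YK iS (h := col)) => A infA i.
  by have [k0 k0P] := colP A infA; exists k0 => k /k0P.
move=> W [uncountW [S woS countS]] cW.
(* Countable segments of an uncountable order are small, so the given order of
   [W] can serve as the initial one. *)
have iS : initial_well_order S.
  split=> // x; apply/negP => le; apply: uncountW.
  exact: sub_countable le (countS x).
have YW := has_cofinality_eq (cofinality_unique cK cW) YK.
have [e eP] := choice (fun k => countable_range k (countS k)).
have [col colP] := splitting_colorings r_eq_c cW iS.
apply: (product_resolvable isoX isoY cfX YW iS (h := fun k n => e k (col k n))) => A infA i.
have [k0 k0P] := colP A infA.
have [i' ii'] := cofinality_no_max infinite_continuum cW iS i.
(* Above [m] the colouring of index [k] is onto omega on [A], and [i] is one of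
   the enumerated predecessors of [k]. *)
have [m [k0m i'm]] : exists m, S k0 m /\ S i' m.
  have [Sk|Si] := well_order_total woS k0 i'.
    by exists i'; split=> //; apply: well_order_refl.
  by exists k0; split=> //; apply: well_order_refl.
exists m => k Smk.
have /eP [n _ en] : below S k i.
  apply/(belowP woS) => Ski; have /(belowP woS) := ii'; apply.
  exact: (well_order_trans woS i'm (well_order_trans woS Smk Ski)).
have [a Aa an] := k0P k (well_order_trans woS k0m Smk) n.
by exists a => //; rewrite an.
Qed.
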